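(* Assume that $\nu$ is a pm valuation on $K[\chi]$, and let $\Phi$ be a non constant monic polynomial in $K[\chi]$ of degree $d<[K(\chi):K]$. Then $\Phi$ is a w key polynomial for $\nu$ if, and only if, there exists a pm valuation $\nu'\le\nu$ such that the restrictions of $\nu$ and $\nu'$ to $K_{d-1}[\chi]$ are equal, and $\Phi$ is a w key polynomial for $\nu'$ such that the sequence $(\Phi^m)$ ($md<[K(\chi):K]$) is ($\nu'$-)separated over $K_{d-1}[\chi]$. Furthermore, one can take $\nu'=\nu_\Phi$.
   Context: $K$ is a field, $\chi\notin K$ is algebraic or transcendental over $K$; $[K[\chi]:K]=[K(\chi):K]=\infty$ if $\chi$ is transcendental. When $\chi$ is algebraic, elements of $K[\chi]$ are written uniquely as polynomials in $\chi$ of degree $<[K[\chi]:K]$, and this gives their degree. $K_m[\chi]$ is the $K$-module of polynomials of degree at most $m$. A $K$-module valuation is a map $\nu$ to $\Gamma\cup\{\infty\}$, $\Gamma$ a linearly ordered abelian group, such that $\nu(y)=\infty\Leftrightarrow y=0$, $\nu(y_1+y_2)\ge\min(\nu(y_1),\nu(y_2))$ and $\nu(xy)=\nu(x)+\nu(y)$ for $x\in K$. It is a pm (partially multiplicative) valuation if $\nu(fg)=\nu(f)+\nu(g)$ for all $f,g\in K[\chi]$ with $\deg(f)+\deg(g)<[K[\chi]:K]$; if $\chi$ is transcendental one requires moreover $\nu(f/g)=\nu(f)-\nu(g)$ for $g\ne0$, i.e. $\nu$ is a field valuation on $K(\chi)$. It is assumed that $\nu K$ has finite rank. $\nu'\le\nu$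 means $\nu'(f)\le\nu(f)$ for all $f\in K[\chi]$. Let $\Phi$ be monic of degree $d$, $1\le d<[K[\chi]:K]$. For $f,g\in K_{d-1}[\chi]$, $q_\Phi(f,g)$ and $r_\Phi(f,g)$ are the quotient and remainder of the euclidean division of the polynomial $fg$ by $\Phi$. $\Phi$ is a w key polynomial for $\nu$ if $\nu(fg)=\nu(r_\Phi(f,g))$ for all $f,g\in K_{d-1}[\chi]$ with $\deg(f)+\deg(g)<[K[\chi]:K]$. Every $f\in K[\chi]$ is written uniquely as $f=f_0+f_1\Phi+\cdots+f_m\Phi^m$ with $f_i\in K_{d-1}[\chi]$ and $\deg(f_m)+dm<[K[\chi]:K]$. The sequence $(\Phi^m)$ ($md<[K[\chi]:K]$) is $\nu$-separated over $K_{d-1}[\chi]$ if $\nu(f)=\min_i\nu(f_i\Phi^i)$ for all such expansions. Define $\nu_\Phi(f):=\min_{0\le i\le m}(\nu(f_i)+i\nu(\Phi))$. *)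

(* Defs.v *)
From HB Require Import structures.
From mathcomp Require Import all_boot all_order all_algebra.

Set Implicit Arguments.
Unset Strict Implicit.
Unset Printing Implicit Defensive.

Import Order.TTheory GRing.Theory Num.Theory.
Local Open Scope ring_scope.

(* Linearly ordered abelian groups. [porderZmodType] alone does not relate the
   order to the addition. *)
HB.mixin Record isLinearlyOrderedGroup G of Num.POrderedZmodule G := {
  grp_le_total : forall x y : G, (x <= y) || (y <= x);
  grp_leD2l : forall x y z : G, y <= z -> x + y <= x + z
}.

#[short(type="orderedGroupType")]
HB.structure Definition OrderedGroup :=
  { G of Num.POrderedZmodule G & isLinearlyOrderedGroup G }.

(* G with a largest element [None] = oo adjoined. *)
Section Extended.
Variable G : orderedGroupType.
Implicit Types x y : option G.

Definition vle x y : bool :=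
  match x, y with
  | _, None => true
  | None, Some _ => false
  | Some a, Some b => a <= b
  end.

Definition vmin x y : option G := if vle x y then x else y.

Definition vadd x y : option G :=
  if (x, y) is (Some a, Some b) then Some (a + b) else None.

(* Only used with y finite; oo - y = oo. *)
Definition vsub x y : option G :=
  if (x, y) is (Some a, Some b) then Some (a - b) else None.

Definition vmuln (i : nat) x : option G := iter i (vadd x) (Some 0).

End Extended.

Definition deg (K : fieldType) (f : {poly K}) : nat := (size f).-1.

(* K_m[X], polynomials of degree at most m *)
Definition poly_le (K : fieldType) (m : nat) (f : {poly K}) : bool :=
  (size f <= m.+1)%N.

Section Adjunction.
Variables (K L : fieldType) (iota : {rmorphism K -> L}) (chi : L).
Implicit Types f g : {poly K}.

Definition ev f : L := (map_poly iota f).[chi].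

Definition Kadj (y : L) : Prop := exists f, y = ev f.

(* m < [K[chi] : K] (in the algebraic and in the transcendental case): K[chi]
   contains m + 1 elements which are linearly independent over K. *)
Definition lt_dim (m : nat) : Prop :=
  exists v : 'I_m.+1 -> L,
    (forall i, Kadj (v i)) /\
    (forall c : 'I_m.+1 -> K,
       \sum_i iota (c i) * v i = 0 -> forall i, c i = 0).

(* The elements of K[chi] are the [ev f] with [lt_dim (deg f)], for a unique
   such f; [deg f] is then the degree of the element. *)

Variable G : orderedGroupType.
Implicit Types nu : L -> option G.

(* A valuation on K[chi] (on K(chi) if chi is transcendental) is a function on
   L of which only the values on that subset are relevant. *)
Definition module_valuation nu : Prop :=
  [/\ forall y, Kadj y -> (nu y = None <-> y = 0),
      forall y1 y2, Kadj y1 -> Kadj y2 ->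
        vle (vmin (nu y1) (nu y2)) (nu (y1 + y2))
    & forall x y, Kadj y -> nu (iota x * y) = vadd (nu (iota x)) (nu y)].

Definition pm_valuation nu : Prop :=
  [/\ module_valuation nu,
      forall f g, lt_dim (deg f + deg g) ->
        nu (ev f * ev g) = vadd (nu (ev f)) (nu (ev g))
    & ~ algebraicOver iota chi -> forall f g, ev g != 0 ->
        nu (ev f / ev g) = vsub (nu (ev f)) (nu (ev g))].

Definition value_group nu (a : G) : Prop :=
  exists2 x : K, x != 0 & nu (iota x) = Some a.

Definition convex_subgroup nu (H : G -> Prop) : Prop :=
  [/\ forall a, H a -> value_group nu a,
      H 0,
      forall a b, H a -> H b -> H (a - b)
    & forall a b, value_group nu a -> H b -> 0 <= a -> a <= b -> H a].

(* The rank of nu K is finite: there are finitely many convex subgroups. *)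
Definition finite_rank nu : Prop :=
  exists (r : nat) (F : 'I_r -> G -> Prop),
    forall H, convex_subgroup nu H ->
      exists i, forall a, H a <-> F i a.

Definition val_le nu' nu : Prop := forall y, Kadj y -> vle (nu' y) (nu y).

(* The remainder r_Phi(f, g) is [(f * g) %% Phi]. *)
Definition w_key nu (Phi : {poly K}) : Prop :=
  forall f g, poly_le (deg Phi).-1 f -> poly_le (deg Phi).-1 g ->
    lt_dim (deg f + deg g) ->
    nu (ev f * ev g) = nu (ev ((f * g) %% Phi)).

(* a_0 + a_1 Phi + ... + a_m Phi^m is a Phi-adic expansion in K[chi]. *)
Definition is_expansion (Phi : {poly K}) m (a : 'I_m.+1 -> {poly K}) : Prop :=
  (forall i, poly_le (deg Phi).-1 (a i)) /\
  lt_dim (deg (a ord_max) + deg Phi * m).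

Definition separated nu (Phi : {poly K}) : Prop :=
  forall m (a : 'I_m.+1 -> {poly K}), is_expansion Phi a ->
    nu (ev (\sum_(i < m.+1) a i * Phi ^+ i)) =
    \big[@vmin G/None]_(i < m.+1) nu (ev (a i * Phi ^+ i)).

(* nu' coincides on K[chi] with nu_Phi. *)
Definition is_nu_Phi nu (Phi : {poly K}) nu' : Prop :=
  forall m (a : 'I_m.+1 -> {poly K}), is_expansion Phi a ->
    nu' (ev (\sum_(i < m.+1) a i * Phi ^+ i)) =
    \big[@vmin G/None]_(i < m.+1)
      vadd (nu (ev (a i))) (vmuln i (nu (ev Phi))).

Definition separated_minorant nu (Phi : {poly K}) nu' : Prop :=
  [/\ pm_valuation nu',
      val_le nu' nu,
      forall f, poly_le (deg Phi).-1 f -> nu' (ev f) = nu (ev f),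
      w_key nu' Phi
    & separated nu' Phi].

End Adjunction.

(* Main.v *)
Require Import Defs.
From Stdlib Require Import ClassicalEpsilon.
From mathcomp Require Import all_boot all_order all_algebra.
From mathcomp Require Import zify.

Set Implicit Arguments.
Unset Strict Implicit.
Unset Printing Implicit Defensive.

(* Let c_k(f) be the Phi-adic digits of f. For digits a, b, write a b = r + q Phi;
   the key property gives nu(r) = nu(a) + nu(b), hence
   nu(q) + nu(Phi) = nu(a b - r) >= nu(a) + nu(b). Summing the products of digits
   shows that every c_k(f g) Phi^k has value at least nu_Phi(f) + nu_Phi(g). If i
   and j are the least indices at which the minima nu_Phi(f) and nu_Phi(g) are
   attained, all the contributions to c_{i+j}(f g) but r(c_i(f), c_j(g)) have too
   large a value, so equality holds for k = i + j and nu_Phi is multiplicative. *)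

Import Order.TTheory GRing.Theory.
Local Open Scope ring_scope.

(** * Order, minima and addition in a linearly ordered group with oo adjoined *)

Section ExtendedGroup.
Variable G : orderedGroupType.
Implicit Types (a b c : G) (x y z t : option G).

Lemma grp_leD2r a b c : (b + a <= c + a) = (b <= c).
Proof.
apply/idP/idP => [|/(grp_leD2l a)]; last by rewrite !(addrC a).
by move=> /(grp_leD2l (- a)); rewrite !(addrC (- a)) !addrK.
Qed.

Lemma vle_refl x : vle x x.
Proof. by case: x => /=. Qed.

Lemma vle_None x : vle x None.
Proof. by case: x. Qed.

Lemma vle_trans y x z : vle x y -> vle y z -> vle x z.
Proof. by case: x y z => [a|] [b|] [c|] //=; apply: le_trans. Qed.

Lemma vle_anti x y : vle x y -> vle y x -> x = y.
Proof.
by case: x y => [a|] [b|] //= ab ba; congr Some; apply/le_anti/andP.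
Qed.

Lemma vle_total x y : vle x y || vle y x.
Proof. by case: x y => [a|] [b|] //=; apply: grp_le_total. Qed.

Lemma vle_min t x y : vle t (vmin x y) = vle t x && vle t y.
Proof.
rewrite /vmin; case: ifP => [xy|/negbT xy].
  by case: (boolP (vle t x)) => // tx; rewrite (vle_trans tx xy).
have yx: vle y x by have := vle_total x y; rewrite (negPf xy).
by rewrite andbC; case: (boolP (vle t y)) => // ty; rewrite (vle_trans ty yx).
Qed.

Lemma vle_bigmin t n (F : 'I_n -> option G) :
  reflect (forall i, vle t (F i)) (vle t (\big[@vmin G/None]_(i < n) F i)).
Proof.
apply: (iffP idP) => [|tF].
  elim: n F => [|n IHn] F; first by move=> _ [].
  rewrite big_ord_recl vle_min => /andP[t0 /IHn tS] i.
  by case: (unliftP ord0 i) => [j ->|->].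
apply: (big_ind (vle t)) => [|x y tx ty|i _]; [exact: vle_None | | exact: tF].
by rewrite vle_min tx.
Qed.

(** By contraposition: the values above a finite bound include oo and are stable under [vmin]. The
    bound must be finite, since the empty minimum is oo. *)
Lemma bigmin_attained a n (F : 'I_n -> option G) :
  vle (\big[@vmin G/None]_(i < n) F i) (Some a) -> exists i, vle (F i) (Some a).
Proof.
move=> minF; apply/existsP; apply: contraLR minF.
rewrite negb_exists => /forallP Fgt.
apply: (big_ind (fun x => ~~ vle x (Some a))) => // x y.
by rewrite /vmin; case: ifP.
Qed.

Lemma vaddC x y : vadd x y = vadd y x.
Proof. by case: x y => [a|] [b|] //; rewrite /vadd addrC. Qed.

Lemma vaddA x y z : vadd x (vadd y z) = vadd (vadd x y) z.
Proof. by case: x y z => [a|] [b|] [c|] //; rewrite /vadd addrA. Qed.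

Lemma vaddACA x y z t :
  vadd (vadd x y) (vadd z t) = vadd (vadd x z) (vadd y t).
Proof. by rewrite -!vaddA (vaddA y) (vaddC y) -vaddA. Qed.

Lemma vadd0 x : vadd x (Some 0) = x.
Proof. by case: x => // a; rewrite /vadd addr0. Qed.

Lemma vadd_None x : vadd x None = None.
Proof. by case: x. Qed.

Lemma vle_add2r a x y : vle (vadd x (Some a)) (vadd y (Some a)) = vle x y.
Proof. by case: x y => [b|] [c|] //; rewrite /vadd /vle grp_leD2r. Qed.

Lemma vle_add x y z t : vle x y -> vle z t -> vle (vadd x z) (vadd y t).
Proof.
case: t => [t|] xy zt; last by rewrite vadd_None vle_None.
case: z zt => [z|] // zt; apply: (@vle_trans (vadd y (Some z))).
  by rewrite vle_add2r.
by case: y {xy} => [y|] //; apply: grp_leD2l.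
Qed.

(** For finite [y], x + y <= a + b <= a + y would give x <= a after cancellation of y; for y = oo
    the sum is oo. *)
Lemma vlt_add a b x y :
  ~~ vle x (Some a) -> vle (Some b) y -> ~~ vle (vadd x y) (Some (a + b)).
Proof.
case: y => [y|]; last by rewrite vadd_None.
move=> xa bY; apply: contra xa => le_xy.
rewrite -(vle_add2r y); apply: vle_trans le_xy _.
exact: grp_leD2l.
Qed.

Lemma vmuln_Some i a : vmuln i (Some a) = Some (a *+ i).
Proof. by elim: i => [|i IHi] //=; rewrite /vmuln /= -/(vmuln _ _) IHi mulrS. Qed.

(** A linearly ordered group has no 2-torsion: adding [a] to a comparison of [a] with 0 gives the
    reverse comparison. This will force nu(-1) = 0. *)
Lemma grp_double_eq0 a : a + a = 0 -> a = 0.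
Proof.
move=> aa; have/orP[a0|a0] := grp_le_total a 0;
  apply/eqP; rewrite eq_le a0 ?andbT /=.
  by have := grp_leD2l a _ _ a0; rewrite aa addr0.
by have := grp_leD2l a _ _ a0; rewrite aa addr0.
Qed.

End ExtendedGroup.

(** * Degree bounds for sums, products and powers *)

Section Degree.
Variable K : fieldType.
Implicit Types f g : {poly K}.

Lemma degD f g : (deg (f + g)%R <= maxn (deg f) (deg g))%N.
Proof.
have: (size (f + g)%R <= maxn (size f) (size g))%N := size_polyD f g.
by rewrite /deg; lia.
Qed.

Lemma degN f : deg (- f) = deg f.
Proof. by rewrite /deg size_polyN. Qed.

Lemma degM f g : (deg (f * g)%R <= deg f + deg g)%N.
Proof.
have: (size (f * g)%R <= (size f + size g).-1)%N := size_polyMleq f g.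
by rewrite /deg; lia.
Qed.

Lemma degX f n : (deg (f ^+ n)%R <= deg f * n)%N.
Proof.
elim: n => [|n IHn]; first by rewrite /deg size_poly1.
by rewrite exprS mulnS; apply: leq_trans (degM _ _) _; rewrite leq_add2l.
Qed.

End Degree.

(** * Phi-adic expansions of polynomials *)

Section Digits.
Variables (K : fieldType) (Phi : {poly K}).
Hypothesis Phi_gt1 : (1 < size Phi)%N.
Implicit Types f g a b : {poly K}.

Fixpoint digit k f : {poly K} :=
  if k is k'.+1 then digit k' (f %/ Phi) else f %% Phi.

Let Phi_neq0 : Phi != 0.
Proof. by rewrite -size_poly_gt0 ltnW. Qed.

Lemma size_quotient f : size (f %/ Phi) = (size f - (size Phi).-1)%N.
Proof. exact: size_divp. Qed.

Lemma deg_quotient f : f %/ Phi != 0 -> (deg (f %/ Phi)%R + deg Phi <= deg f)%N.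
Proof. by rewrite -size_poly_gt0 /deg size_quotient; lia. Qed.

(** The product has degree at most 2d - 2. Hence a product of two digits has at most two nonzero
    digits itself, its remainder and its quotient. *)
Lemma size_quotient_mul a b : (size a < size Phi)%N -> (size b < size Phi)%N ->
  (size ((a * b) %/ Phi)%R < size Phi)%N.
Proof.
have: (size (a * b)%R <= (size a + size b).-1)%N := size_polyMleq a b.
by rewrite size_quotient; lia.
Qed.

Lemma digitS k f : digit k.+1 f = digit k (f %/ Phi).
Proof. by []. Qed.

Lemma digitD k f g : digit k (f + g) = digit k f + digit k g.
Proof.
by elim: k f g => [|k IHk] f g /=; rewrite ?modpD // divpD IHk.
Qed.

Lemma digit0 k : digit k 0 = 0.
Proof. by elim: k => [|k IHk] /=; rewrite ?mod0p ?div0p. Qed.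

Lemma digit_sum k I r (P : pred I) (F : I -> {poly K}) :
  digit k (\sum_(i <- r | P i) F i) = \sum_(i <- r | P i) digit k (F i).
Proof. by apply: big_morph; [exact: digitD | exact: digit0]. Qed.

Lemma size_digit k f : (size (digit k f) < size Phi)%N.
Proof. by elim: k f => [|k IHk] f //=; rewrite ltn_modp. Qed.

(** A nonzero digit guarantees that the truncated subtraction in [size_quotient] is exact at each of
    the [k] divisions. *)
Lemma size_digit_addn k f : digit k f != 0 ->
  (size (digit k f) + (size Phi).-1 * k <= size f)%N.
Proof.
elim: k f => [|k IHk] f; first by rewrite muln0 addn0 leq_modp.
rewrite digitS => nz; have := IHk (f %/ Phi) nz; rewrite size_quotient.
have: (0 < size (digit k (f %/ Phi)))%N by rewrite size_poly_gt0.
by rewrite mulnS; move: (_ * k)%N => n; lia.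
Qed.

Lemma deg_digit k f : (deg (digit k f) <= deg f)%N.
Proof.
case: (eqVneq (digit k f) 0) => [->|nz]; first by rewrite /deg size_poly0.
rewrite /deg -!subn1 leq_sub2r //; apply: leq_trans (size_digit_addn nz).
exact: leq_addr.
Qed.

Lemma digit_large k f : (size f <= k)%N -> digit k f = 0.
Proof.
move=> fk; apply/eqP; apply: contraLR fk => nz; rewrite -ltnNge.
have := size_digit_addn nz; have: (0 < size (digit k f))%N by rewrite size_poly_gt0.
have: (k <= (size Phi).-1 * k)%N by rewrite leq_pmull //; lia.
lia.
Qed.

Lemma digit_small k f : (size f < size Phi)%N ->
  digit k f = if k is 0 then f else 0.
Proof. by case: k => [|k] lt_f /=; rewrite ?modp_small // divp_small // digit0. Qed.

Lemma digit_mulX k n f :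
  digit k (f * Phi ^+ n) = if (k < n)%N then 0 else digit (k - n) f.
Proof.
elim: n k => [|n IHn] [|k] //=; rewrite ?mulr1 // exprSr mulrA.
  by rewrite modp_mull.
by rewrite mulpK // IHn.
Qed.

(** Every division by Phi lowers a nonzero size by at least one, so [size f] terms always suffice;
    the surplus digits are zero. *)
Lemma digit_expansion f : f = \sum_(i < size f) digit i f * Phi ^+ i.
Proof.
suff: forall n g, (size g <= n)%N -> g = \sum_(i < n) digit i g * Phi ^+ i.
  by apply.
elim=> [|n IHn] g; first by rewrite big_ord0 leqn0 size_poly_eq0 => /eqP.
move=> gn; rewrite big_ord_recl expr0 mulr1 {1}(divp_eq g Phi) addrC.
congr (_ + _); rewrite {1}(IHn (g %/ Phi)); last by rewrite size_quotient; lia.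
by rewrite mulr_suml; apply: eq_bigr => i _; rewrite exprSr mulrA.
Qed.

(** Uniqueness of the expansion: digits are additive, and a_i Phi^i has a_i as its only possibly
    nonzero digit, at index i. *)
Lemma digit_of_expansion k m (a : 'I_m -> {poly K}) :
  (forall i, size (a i) < size Phi)%N ->
  digit k (\sum_(i < m) a i * Phi ^+ i) =
    if insub k is Some i then a i else 0.
Proof.
move=> lt_a; rewrite digit_sum.
have digE i: digit k (a i * Phi ^+ i) = if (i : nat) == k then a i else 0.
  rewrite digit_mulX digit_small //.
  by case: ltngtP => [||->]; rewrite ?subnn // -subn_gt0; case: (k - i)%N.
under eq_bigr do rewrite digE.
case: insubP => [i lt_k ik|].
  rewrite (bigD1 i) //= ik eqxx big1 ?addr0 // => j ji.
  by case: eqP => // jk; case/eqP: ji; apply: val_inj; exact: etrans jk (esym ik).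
rewrite -leqNgt => mk; rewrite big1 // => i _.
by case: eqP => // ik; have := ltn_ord i; rewrite ik ltnNge mk.
Qed.

Lemma digit_mul f g k : digit k (f * g) =
  \sum_(i < size f) \sum_(j < size g)
     digit k (digit i f * digit j g * Phi ^+ (i + j)).
Proof.
rewrite {1}(digit_expansion f) {1}(digit_expansion g) mulr_suml digit_sum.
apply: eq_bigr => i _; rewrite mulr_sumr digit_sum.
by apply: eq_bigr => j _; rewrite mulrACA exprD.
Qed.

End Digits.

(** * The dimension of K[chi] and reduced representatives of its elements *)

Section Dimension.
Variables (K L : fieldType) (iota : {rmorphism K -> L}) (chi : L).
Implicit Types f g : {poly K}.
Local Notation ev := (ev iota chi).
Local Notation lt_dim := (lt_dim iota chi).

Lemma evD f g : ev (f + g) = ev f + ev g.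
Proof. by rewrite /Defs.ev rmorphD hornerD. Qed.

Lemma evM f g : ev (f * g) = ev f * ev g.
Proof. by rewrite /Defs.ev rmorphM hornerM. Qed.

Lemma evC c : ev c%:P = iota c.
Proof. by rewrite /Defs.ev map_polyC hornerC. Qed.

Lemma ev0 : ev 0 = 0.
Proof. by rewrite /Defs.ev rmorph0 horner0. Qed.

Lemma ev1 : ev 1 = 1.
Proof. by rewrite /Defs.ev rmorph1 hornerC. Qed.

Lemma evZ c f : ev (c *: f) = iota c * ev f.
Proof. by rewrite -mul_polyC evM evC. Qed.

Lemma evN f : ev (- f) = - ev f.
Proof. by rewrite /Defs.ev rmorphN hornerN. Qed.

Lemma ev_sum I r (P : pred I) (F : I -> {poly K}) :
  ev (\sum_(i <- r | P i) F i) = \sum_(i <- r | P i) ev (F i).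
Proof. by apply: big_morph; [exact: evD | exact: ev0]. Qed.

Lemma ev_mod f p : ev p = 0 -> ev (f %% p) = ev f.
Proof. by move=> p0; rewrite [in RHS](divp_eq f p) evD evM p0 mulr0 add0r. Qed.

(** If a nonzero f of degree at most m vanishes at chi, remainders modulo f span K[chi] in dimension
    at most m, so no m + 1 elements are free. Conversely, the powers 1, chi, ..., chi^m are free. *)
Lemma lt_dimP m :
  lt_dim m <-> (forall f, (size f <= m.+1)%N -> ev f = 0 -> f = 0).
Proof.
split=> [[v [vK v_free]] f le_f f0|ev_inj].
  apply/eqP; case: (eqVneq f 0) => // f_neq0.
  pose p i := sval (constructive_indefinite_description _ (vK i)).
  have pE i: v i = ev (p i %% f).
    rewrite ev_mod //; exact: (svalP (constructive_indefinite_description _ (vK i))).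
  (* The rows are the coefficients of the remainders. There are at most m columns for m + 1 rows, so
     the left kernel contains a nonzero dependence relation. *)
  pose A := \matrix_(i < m.+1, j < (size f).-1) (p i %% f)`_j.
  have /rowV0Pn[c /sub_kermxP cA c_neq0]: kermx A != 0.
    rewrite -mxrank_eq0 mxrank_ker -lt0n subn_gt0.
    apply: leq_ltn_trans (rank_leq_col A) _.
    by move: f_neq0; rewrite -size_poly_gt0; lia.
  have sum0: \sum_i c 0 i *: (p i %% f) = 0.
    apply/polyP=> j; rewrite coef_sum coef0.
    case: (ltnP j (size f).-1) => [lt_j|le_j].
      have := congr1 (fun B : 'rV_ _ => B 0 (Ordinal lt_j)) cA.
      rewrite !mxE; apply: etrans.
      by apply: eq_bigr => i _; rewrite mxE coefZ.
    rewrite big1 // => i _; rewrite coefZ nth_default ?mulr0 //.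
    apply: leq_trans le_j; rewrite -ltnS prednK ?size_poly_gt0 //.
    exact: ltn_modpN0.
  case/eqP: c_neq0; apply/rowP=> i; rewrite mxE; apply: v_free => {i}.
  transitivity (ev (\sum_i c 0 i *: (p i %% f))); last by rewrite sum0 ev0.
  by rewrite ev_sum; apply: eq_bigr => i _; rewrite evZ pE.
exists (fun i => chi ^+ i); split=> [i|c c0 i].
  by exists 'X^i; rewrite /Defs.ev map_polyXn hornerXn.
pose f := \poly_(j < m.+1) c (inord j).
suff f0: f = 0.
  by have := coef0 K i; rewrite -f0 coef_poly ltn_ord inord_val.
apply: ev_inj; first exact: size_poly.
rewrite -[RHS]c0 /f poly_def ev_sum; apply: eq_bigr => j _.
by rewrite evZ inord_val /Defs.ev map_polyXn hornerXn.
Qed.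

Lemma lt_dim_leq m n : (m <= n)%N -> lt_dim n -> lt_dim m.
Proof.
move=> mn /lt_dimP Dn; apply/lt_dimP => f fm; apply: Dn.
by apply: leq_trans fm _.
Qed.

Lemma lt_dim_ev_eq0 f : lt_dim (deg f) -> ev f = 0 -> f = 0.
Proof. by move=> /lt_dimP; apply; rewrite /deg leqSpred. Qed.

Lemma lt_dim_ev_inj f g :
  lt_dim (deg f) -> lt_dim (deg g) -> ev f = ev g -> f = g.
Proof.
wlog le_fg: f g / (deg f <= deg g)%N.
  move=> IH Df Dg fg; have [|/ltnW] := leqP (deg f) (deg g) => le_fg.
    exact: IH.
  by apply/esym/IH.
move=> _ Dg fg; apply/eqP; rewrite -subr_eq0; apply/eqP.
apply: lt_dim_ev_eq0; last by rewrite evD evN fg subrr.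
apply: lt_dim_leq Dg.
by apply: leq_trans (degD _ _) _; rewrite degN geq_max le_fg leqnn.
Qed.

Lemma lt_dim_transcendental m : ~ algebraicOver iota chi -> lt_dim m.
Proof.
move=> trans; apply/lt_dimP=> f _ f0; apply/eqP.
by case: (eqVneq f 0) => // nz; case: trans; exists f => //; apply/eqP.
Qed.

(** If the degree of f is too large, chi is algebraic, and f can be reduced modulo a nonzero
    polynomial of least size vanishing at chi, that is, a minimal polynomial up to a scalar. *)
Lemma Kadj_reduced y : Kadj iota chi y -> exists2 f, lt_dim (deg f) & y = ev f.
Proof.
move=> [f ->]; case: (excluded_middle_informative (lt_dim (deg f))) => [|notD].
  by exists f.
have [p p0 [p_neq0 p_min]]: exists2 p, ev p = 0 & p != 0 /\
    forall q, ev q = 0 -> (size q < size p)%N -> q = 0.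
  have [p0 p0_neq0 /eqP ev_p0]: algebraicOver iota chi.
    apply: NNPP => trans; apply: notD; exact: lt_dim_transcendental.
  have [n] := ubnP (size p0); elim: n p0 p0_neq0 ev_p0 => // n IHn p nz p0 le_p.
  have [[q [q0 lt_q q_neq0]]|noq] := classic
      (exists q, [/\ ev q = 0, (size q < size p)%N & q != 0]).
    by apply: (IHn q) => //; lia.
  exists p => //; split=> // q q0 lt_q; apply/eqP.
  by case: (eqVneq q 0) => // q_neq0; case: noq; exists q.
exists (f %% p); last by rewrite ev_mod.
apply/lt_dimP => q le_q q0; apply: p_min => //; apply: leq_ltn_trans le_q _.
have := ltn_modpN0 f p_neq0; rewrite /deg.
case: (size (f %% p)) => [|//] _ /=.
(* A zero remainder also has [deg] 0, so it remains to see that p is not constant: a constant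
   vanishing at chi is zero. *)
rewrite ltnNge; apply/negP => /size1_polyC pC.
move: p0 p_neq0; rewrite pC evC => /eqP; rewrite fmorph_eq0 polyC_eq0 => ->.
by [].
Qed.

End Dimension.

(** * Values under nu, and the function nu_Phi on polynomials *)

Section PhiValuation.
Variables (K L : fieldType) (iota : {rmorphism K -> L}) (chi : L).
Variables (G : orderedGroupType) (nu : L -> option G) (Phi : {poly K}).
Local Notation ev := (ev iota chi).
Local Notation lt_dim := (lt_dim iota chi).
Hypothesis nu_mod : module_valuation iota chi nu.
Hypothesis nu_mul : forall f g, lt_dim (deg f + deg g) ->
  nu (ev f * ev g) = vadd (nu (ev f)) (nu (ev g)).
Hypothesis Phi_nonconst : (0 < deg Phi)%N.
Hypothesis Phi_deg : lt_dim (deg Phi).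
Implicit Types (f g a b : {poly K}) (Q : option G -> bool).

Local Notation u f := (nu (ev f)).

Let Phi_gt1 : (1 < size Phi)%N.
Proof. by move: Phi_nonconst; rewrite /deg; lia. Qed.

Lemma val_ev0 : u 0 = None.
Proof. by have [nu0 _ _] := nu_mod; apply/nu0; [exists 0 | exact: ev0]. Qed.

Lemma val_ev_eq0 f : lt_dim (deg f) -> u f = None -> f = 0.
Proof.
have [nu0 _ _] := nu_mod => Df uf; apply: lt_dim_ev_eq0 Df _.
by apply/nu0 => //; exists f.
Qed.

Lemma val_evM f g : lt_dim (deg f + deg g) -> u (f * g) = vadd (u f) (u g).
Proof. by move=> D; rewrite evM nu_mul. Qed.

Lemma val_ev1 : u 1 = Some 0.
Proof.
have D0: lt_dim 0 by apply: lt_dim_leq Phi_deg.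
have d1: deg (1 : {poly K}) = 0%N by rewrite /deg size_poly1.
have: u (1 * 1) = vadd (u 1) (u 1) by apply: val_evM; rewrite d1.
rewrite mulr1; case E: (u 1) => [c|]; last first.
  by case/eqP: (oner_neq0 {poly K}); apply: val_ev_eq0 E; rewrite d1.
by case=> /(congr1 (fun z => z - c)); rewrite subrr addrK => <-.
Qed.

(** From 2 nu(-1) = nu(1) = 0 and the absence of 2-torsion, nu(-1) = 0. *)
Lemma val_evN f : u (- f) = u f.
Proof.
have D0: lt_dim 0 by apply: lt_dim_leq Phi_deg.
have dN1: deg (- 1 : {poly K}) = 0%N by rewrite degN /deg size_poly1.
have N1: u (- 1) = Some 0.
  have: u (- 1 * - 1) = vadd (u (- 1)) (u (- 1)) by apply: val_evM; rewrite dN1.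
  rewrite mulrNN mulr1 val_ev1; case: (u (- 1)) => // c [/esym].
  by move=> /grp_double_eq0 ->.
have [_ _ nuZ] := nu_mod.
have C1: ev (- 1) = iota (- 1) by rewrite -(evC iota chi) polyCN polyC1.
rewrite -mulN1r evM C1 nuZ; last by exists f.
by rewrite -C1 N1 vaddC vadd0.
Qed.

(** Common form of the bounds by >= and by >, so that the ultrametric inequality for finite sums is
    proved once for both. *)
Definition up_closed Q := Q None /\ forall x y, vle x y -> Q x -> Q y.

Lemma up_closed_ge t (c : G) : up_closed (fun x => vle t (vadd x (Some c))).
Proof.
split=> [|x y xy tx]; first by rewrite vaddC vadd_None vle_None.
by apply: vle_trans tx _; rewrite vle_add2r.
Qed.

Lemma up_closed_gt s (c : G) :
  up_closed (fun x => ~~ vle (vadd x (Some c)) (Some s)).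
Proof.
split=> [|x y xy]; first by rewrite vaddC vadd_None.
by apply: contra => ys; apply: vle_trans ys; rewrite vle_add2r.
Qed.

Lemma val_evD_up Q f g : up_closed Q -> Q (u f) -> Q (u g) -> Q (u (f + g)).
Proof.
move=> [_ upQ] Qf Qg; have [_ nuD _] := nu_mod.
rewrite evD; apply: upQ (nuD _ _ _ _) _; [by exists f | by exists g |].
by rewrite /vmin; case: ifP.
Qed.

Lemma val_ev_sum_up Q (I : Type) (r : seq I) (P : pred I) (F : I -> {poly K}) :
  up_closed Q -> (forall i, P i -> Q (u (F i))) ->
  Q (u (\sum_(i <- r | P i) F i)).
Proof.
move=> upQ QF; apply: (big_ind (fun f => Q (u f))) => [|f g|//].
  by rewrite val_ev0; case: upQ.
exact: val_evD_up.
Qed.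

Lemma poly_leE f : poly_le (deg Phi).-1 f = (size f < size Phi)%N.
Proof. by move: Phi_gt1; rewrite /poly_le /deg; case: (size Phi) => [|[]]. Qed.

Lemma poly_le_mod f : poly_le (deg Phi).-1 (f %% Phi).
Proof. by rewrite poly_leE; apply: (size_digit Phi_gt1 0). Qed.

Lemma lt_dim_small f : (size f < size Phi)%N -> lt_dim (deg f).
Proof. by move=> fP; apply: lt_dim_leq Phi_deg; rewrite /deg; lia. Qed.

Lemma val_ev_mulXn f n : lt_dim (deg f + deg Phi * n) ->
  u (f * Phi ^+ n) = vadd (u f) (vmuln n (u Phi)).
Proof.
elim: n => [|n IHn] D; first by rewrite mulr1 vadd0.
have D1: lt_dim (deg (f * Phi ^+ n) + deg Phi).
  apply: lt_dim_leq D; rewrite mulnSr addnA leq_add2r.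
  by apply: leq_trans (degM _ _) _; rewrite leq_add2l degX.
rewrite exprSr mulrA val_evM // IHn; last by apply: lt_dim_leq D; lia.
by rewrite -vaddA [vadd (vmuln _ _) _]vaddC.
Qed.

(** Taken on polynomials of any degree, before evaluation at chi. Digits of index at least [size f]
    are zero and contribute oo, so no term of the minimum is missing. *)
Definition nuPhi f : option G :=
  \big[@vmin G/None]_(k < size f) vadd (u (digit Phi k f)) (vmuln k (u Phi)).

Lemma vle_nuPhi t f :
  reflect (forall k, vle t (vadd (u (digit Phi k f)) (vmuln k (u Phi))))
          (vle t (nuPhi f)).
Proof.
apply: (iffP (vle_bigmin _ _)) => tf k; last exact: tf.
case: (ltnP k (size f)) => [lt_k|le_k]; first exact: (tf (Ordinal lt_k)).
by rewrite digit_large // val_ev0 vaddC vadd_None vle_None.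
Qed.

Lemma nuPhi_le f k : vle (nuPhi f) (vadd (u (digit Phi k f)) (vmuln k (u Phi))).
Proof. exact: (vle_nuPhi _ _ (vle_refl _)). Qed.

Lemma nuPhi_expansion m (a : 'I_m -> {poly K}) :
  (forall i, size (a i) < size Phi)%N ->
  nuPhi (\sum_(i < m) a i * Phi ^+ i) =
    \big[@vmin G/None]_(i < m) vadd (u (a i)) (vmuln i (u Phi)).
Proof.
move=> lt_a; apply: vle_anti.
  apply/vle_bigmin => i; have := nuPhi_le (\sum_(i < m) a i * Phi ^+ i) i.
  by rewrite digit_of_expansion // valK.
apply/vle_nuPhi => k; rewrite digit_of_expansion //.
case: insubP => [i _ <-|_]; first by apply: (vle_bigmin _ _ (vle_refl _)).
by rewrite val_ev0 vaddC vadd_None vle_None.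
Qed.

Lemma nuPhi_mulXn f n : (size f < size Phi)%N ->
  nuPhi (f * Phi ^+ n) = vadd (u f) (vmuln n (u Phi)).
Proof.
move=> lt_f; apply: vle_anti.
  have := nuPhi_le (f * Phi ^+ n) n.
  by rewrite digit_mulX // ltnn subnn digit_small.
apply/vle_nuPhi => k; rewrite digit_mulX // digit_small //.
case: ltngtP => [_|lt_nk|->]; last by rewrite subnn vle_refl.
  by rewrite val_ev0; apply: vle_None.
by rewrite -subn_gt0 in lt_nk; case: (k - n)%N lt_nk => // l _;
   rewrite val_ev0; apply: vle_None.
Qed.

Lemma nuPhi_small f : (size f < size Phi)%N -> nuPhi f = u f.
Proof.
move=> fP; have := nuPhi_expansion (a := fun _ : 'I_1 => f).
rewrite !big_ord_recl !big_ord0 mulr1 addr0 vadd0 => -> //.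
by rewrite /vmin vle_None.
Qed.

Lemma nuPhi0 : nuPhi 0 = None.
Proof. by rewrite nuPhi_small ?val_ev0 // size_poly0 ltnW. Qed.

Lemma nuPhi1 : nuPhi 1 = Some 0.
Proof. by rewrite nuPhi_small ?val_ev1 // size_poly1. Qed.

Section FiniteValue.
Variable v : G.
Hypothesis PhiE : u Phi = Some v.

(** Since nu(Phi) is finite, every digit has value oo; having degree below d, each digit is then
    zero as a polynomial. *)
Lemma nuPhi_eq0 f : nuPhi f = None -> f = 0.
Proof.
move=> fN; rewrite (digit_expansion Phi_gt1 f) big1 // => i _.
have := nuPhi_le f i; rewrite fN PhiE vmuln_Some.
case E: (u _) => // _; rewrite (val_ev_eq0 _ E) ?mul0r //.
exact/lt_dim_small/size_digit.
Qed.

Lemma nuPhiD f g : vle (vmin (nuPhi f) (nuPhi g)) (nuPhi (f + g)).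
Proof.
apply/vle_nuPhi => k; rewrite digitD PhiE vmuln_Some.
apply: (val_evD_up (up_closed_ge _ _)).
  by have := nuPhi_le f k; rewrite PhiE vmuln_Some; apply: vle_trans;
     have := vle_refl (vmin (nuPhi f) (nuPhi g)); rewrite vle_min => /andP[].
by have := nuPhi_le g k; rewrite PhiE vmuln_Some; apply: vle_trans;
   have := vle_refl (vmin (nuPhi f) (nuPhi g)); rewrite vle_min => /andP[].
Qed.

(** The terms of the expansion stay within the degree range where nu is multiplicative, so nu(f_i
    Phi^i) = nu(f_i) + i nu(Phi), and nu of the sum is at least the minimum. *)
Lemma nuPhi_le_val f : lt_dim (deg f) -> vle (nuPhi f) (u f).
Proof.
move=> Df; rewrite [X in u X](digit_expansion Phi_gt1 f).
have up0 := up_closed_ge (nuPhi f) 0.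
have := val_ev_sum_up (index_enum 'I_(size f)) (P := predT)
  (F := fun i => digit Phi i f * Phi ^+ i) up0.
rewrite vadd0; apply=> i _; rewrite vadd0.
case: (eqVneq (digit Phi i f) 0) => [->|nz].
  by rewrite mul0r val_ev0 vle_None.
rewrite val_ev_mulXn; first exact: nuPhi_le.
apply: lt_dim_leq Df; have := size_digit_addn Phi_gt1 nz.
have: (0 < size (digit Phi i f))%N by rewrite size_poly_gt0.
by rewrite /deg; move: (_ * i)%N => n; lia.
Qed.

Hypothesis Phi_key : w_key iota chi nu Phi.

(** * Values of the digits of a product of two digits *)

Section DigitProducts.
Variables (a b : {poly K}).
Hypotheses (lt_a : (size a < size Phi)%N) (lt_b : (size b < size Phi)%N).
Hypothesis Dab : lt_dim (deg a + deg b).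

Lemma val_remainder : u ((a * b) %% Phi) = vadd (u a) (u b).
Proof. by rewrite -nu_mul // Phi_key // poly_leE. Qed.

Lemma val_quotient : vle (vadd (u a) (u b)) (vadd (u ((a * b) %/ Phi)) (Some v)).
Proof.
case: (eqVneq ((a * b) %/ Phi) 0) => [->|nz].
  by rewrite val_ev0 vaddC vle_None.
(* The degrees of q and Phi add up to at most deg a + deg b, so nu(q) + nu(Phi) = nu(q Phi); then q
   Phi = a b - r, both terms of value nu(a) + nu(b). *)
rewrite -PhiE -(val_evM (f := (a * b) %/ Phi)); last first.
  apply: lt_dim_leq Dab; exact: leq_trans (deg_quotient Phi_gt1 nz) (degM a b).
have <-: a * b - (a * b) %% Phi = (a * b) %/ Phi * Phi.
  by rewrite {1}(divp_eq (a * b) Phi) addrK.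
rewrite -(vadd0 (u (_ - _))).
apply: (val_evD_up (up_closed_ge (vadd (u a) (u b)) 0)); rewrite vadd0.
  by rewrite val_evM // vle_refl.
by rewrite val_evN val_remainder vle_refl.
Qed.

Lemma val_digit_mul_ge n k :
  vle (vadd (vadd (u a) (u b)) (Some (v *+ n)))
      (vadd (u (digit Phi k (a * b * Phi ^+ n))) (Some (v *+ k))).
Proof.
rewrite digit_mulX //; case: ltnP => [_|nk]; first by rewrite val_ev0 vaddC vle_None.
(* The digit is the remainder for k = n, the quotient for k = n + 1, and zero beyond. *)
rewrite -{2}(subnK nk) mulrnDr; case: (k - n)%N => [|[|l]] /=.
- by rewrite val_remainder mulr0n add0r vle_refl.
- rewrite modp_small; last exact: size_quotient_mul.
  rewrite (_ : Some (_ + _) = vadd (Some v) (Some (v *+ n))) // vaddA vle_add2r.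
  exact: val_quotient.
- rewrite divp_small; last exact: size_quotient_mul.
  by rewrite digit0 val_ev0 vaddC vle_None.
Qed.

Lemma val_digit_mul n :
  u (digit Phi n (a * b * Phi ^+ n)) = vadd (u a) (u b).
Proof. by rewrite digit_mulX // ltnn subnn val_remainder. Qed.

End DigitProducts.

(** A finite minimum is attained. The least index makes all earlier terms strictly larger, which
    will isolate a single product in [nuPhiM]. *)
Lemma least_digit f c : nuPhi f = Some c ->
  exists2 i, vle (vadd (u (digit Phi i f)) (Some (v *+ i))) (Some c) &
    forall j, (j < i)%N -> ~~ vle (vadd (u (digit Phi j f)) (Some (v *+ j))) (Some c).
Proof.
move=> fc; pose P i := vle (vadd (u (digit Phi i f)) (Some (v *+ i))) (Some c).
have exP: exists i, P i.
  have: vle (nuPhi f) (Some c) by rewrite fc vle_refl.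
  by move=> /bigmin_attained[i]; rewrite PhiE vmuln_Some; exists i.
case: (ex_minnP exP) => i Pi min_i; exists i => // j ji.
by apply: contraL ji => /min_i; rewrite leqNgt.
Qed.

Lemma lt_dim_digits f g i j : lt_dim (deg f + deg g) ->
  lt_dim (deg (digit Phi i f) + deg (digit Phi j g)).
Proof.
by apply: lt_dim_leq; apply: leq_add; apply: deg_digit.
Qed.

Lemma nuPhiM f g : lt_dim (deg f + deg g) ->
  nuPhi (f * g) = vadd (nuPhi f) (nuPhi g).
Proof.
move=> Dfg; case Ef: (nuPhi f) => [cf|]; last first.
  by rewrite (nuPhi_eq0 Ef) mul0r nuPhi0.
case Eg: (nuPhi g) => [cg|]; last first.
  by rewrite (nuPhi_eq0 Eg) mulr0 nuPhi0.
have lt_digit h k : (size (digit Phi k h) < size Phi)%N by exact: size_digit.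
pose T i j := digit Phi i f * digit Phi j g * Phi ^+ (i + j).
have term_ge i j k : vle
    (vadd (vadd (u (digit Phi i f)) (Some (v *+ i)))
          (vadd (u (digit Phi j g)) (Some (v *+ j))))
    (vadd (u (digit Phi k (T i j))) (Some (v *+ k))).
  rewrite vaddACA (_ : vadd (Some _) (Some _) = Some (v *+ (i + j))).
    by apply: val_digit_mul_ge => //; apply: lt_dim_digits.
  by rewrite /vadd mulrnDr.
have f_ge i : vle (Some cf) (vadd (u (digit Phi i f)) (Some (v *+ i))).
  by have := nuPhi_le f i; rewrite Ef PhiE vmuln_Some.
have g_ge i : vle (Some cg) (vadd (u (digit Phi i g)) (Some (v *+ i))).
  by have := nuPhi_le g i; rewrite Eg PhiE vmuln_Some.
(* The inequality >= comes first: each product of digits contributes at least [cf + cg] to every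
   digit of f g. *)
apply: vle_anti; last first.
  apply/vle_nuPhi => k; rewrite (digit_mul Phi_gt1) PhiE vmuln_Some.
  have up := up_closed_ge (vadd (Some cf) (Some cg)) (v *+ k).
  apply: (val_ev_sum_up _ up) => i _; apply: (val_ev_sum_up _ up) => j _.
  by apply: vle_trans (term_ge _ _ _); apply: vle_add.
have [i0 le_i0 min_i0] := least_digit Ef; have [j0 le_j0 min_j0] := least_digit Eg.
apply: vle_trans (nuPhi_le _ (i0 + j0)) _; rewrite PhiE vmuln_Some.
have up := up_closed_gt (cf + cg) (v *+ (i0 + j0)).
have T_gt i j : (i != i0) || (j != j0) ->
    ~~ vle (vadd (u (digit Phi (i0 + j0) (T i j))) (Some (v *+ (i0 + j0))))
           (Some (cf + cg)).
  (* Either i < i0 or j < j0, and strictness comes from the minimality of that index; or i + j > i0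
     + j0, and the digit at i0 + j0 is zero. *)
  move=> ij; case: (ltnP i i0) => [lt_i|le_i].
    apply: contra (vlt_add (min_i0 _ lt_i) (g_ge j)); apply: vle_trans.
    exact: term_ge.
  case: (ltnP j j0) => [lt_j|le_j].
    have := vlt_add (min_j0 _ lt_j) (f_ge i); rewrite vaddC addrC.
    by apply: contra; apply: vle_trans; exact: term_ge.
  rewrite digit_mulX // (_ : (_ < _)%N); first by rewrite val_ev0 vaddC.
  by move: ij; lia.
have lt_i0 : (i0 < size f)%N.
  rewrite ltnNge; apply/negP => le_f; move: le_i0.
  by rewrite digit_large // val_ev0 vaddC.
have lt_j0 : (j0 < size g)%N.
  rewrite ltnNge; apply/negP => le_g; move: le_j0.
  by rewrite digit_large // val_ev0 vaddC.
rewrite (digit_mul Phi_gt1) (bigD1 (Ordinal lt_i0)) //=.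
rewrite (bigD1 (Ordinal lt_j0)) //= -addrA -/(T i0 j0).
set rest := (X in _ + X).
have rest_gt : ~~ vle (vadd (u (- rest)) (Some (v *+ (i0 + j0)))) (Some (cf + cg)).
  rewrite val_evN; apply: (val_evD_up up).
    by apply: (val_ev_sum_up _ up) => j jj; apply: T_gt; rewrite jj orbT.
  apply: (val_ev_sum_up _ up) => i ii; apply: (val_ev_sum_up _ up) => j _.
  by apply: T_gt; rewrite ii.
(* If the whole digit had value above [cf + cg], subtracting [rest] would give the same for the term
   (i0, j0), whose value is known by [val_digit_mul]. *)
apply: contraT => sum_gt.
have := val_evD_up up sum_gt rest_gt; rewrite addrK.
rewrite val_digit_mul //; last exact: lt_dim_digits.
rewrite (_ : Some _ = vadd (Some (v *+ i0)) (Some (v *+ j0))).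
  by rewrite vaddACA (vle_add le_i0 le_j0).
by rewrite /vadd mulrnDr.
Qed.

End FiniteValue.

(** * Degrees in the Phi-adic expansions of elements of K[chi] *)

Lemma is_expansion_size m (a : 'I_m.+1 -> {poly K}) i :
  is_expansion iota chi Phi a -> (size (a i) < size Phi)%N.
Proof. by case=> /(_ i); rewrite poly_leE. Qed.

Lemma is_expansion_lt_dim m (a : 'I_m.+1 -> {poly K}) i :
  is_expansion iota chi Phi a -> lt_dim (deg (a i) + deg Phi * i).
Proof.
move=> exp_a; have [_ Da] := exp_a.
case: (eqVneq i ord_max) => [->|ni]; first exact: Da.
apply: lt_dim_leq Da; have lt_i : (i < m)%N.
  by have := ltn_ord i; rewrite ltnS leq_eqVlt => /orP[/eqP im|//];
     case/eqP: ni; apply: val_inj.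
(* For i < m, deg(a_i) + d i is at most d (i + 1), hence at most d m, which the leading term already
   bounds. *)
apply: (@leq_trans (deg Phi * i.+1)); last first.
  by apply: leq_trans (leq_addl _ _); rewrite leq_mul2l lt_i orbT.
rewrite mulnS leq_add2r.
by have := is_expansion_size i exp_a; rewrite /deg; lia.
Qed.

Lemma is_expansion_lt_dim_sum m (a : 'I_m.+1 -> {poly K}) :
  is_expansion iota chi Phi a -> lt_dim (deg (\sum_(i < m.+1) a i * Phi ^+ i)).
Proof.
move=> exp_a; apply: (big_ind (fun f => lt_dim (deg f))) => [|f g Df Dg|i _].
- by apply: lt_dim_leq Phi_deg; rewrite /deg size_poly0.
- by apply: lt_dim_leq (degD f g) _; rewrite /maxn; case: ifP.
apply: lt_dim_leq (is_expansion_lt_dim i exp_a).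
by apply: leq_trans (degM _ _) _; rewrite leq_add2l degX.
Qed.

End PhiValuation.

(** * Descent of nu_Phi to a pm valuation on K[chi] or K(chi) *)

Section Minorant.
Variables (K L : fieldType) (iota : {rmorphism K -> L}) (chi : L).
Variables (G : orderedGroupType) (nu : L -> option G) (Phi : {poly K}).
Local Notation ev := (ev iota chi).
Local Notation lt_dim := (lt_dim iota chi).
Local Notation nuPhi := (nuPhi iota chi nu Phi).
Hypothesis nu_pm : pm_valuation iota chi nu.
Hypothesis Phi_nonconst : (0 < deg Phi)%N.
Hypothesis Phi_deg : lt_dim (deg Phi).
Implicit Types f g : {poly K}.

(* Fractions with [g <> 1] are excluded in the algebraic case: [nuPhi] is not
   multiplicative there, so [vsub (nuPhi f) (nuPhi g)] would depend on [f, g]. *)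
Definition minorant_rel (y : L) (o : option G) : Prop :=
  exists f g, [/\ lt_dim (deg f), ~ algebraicOver iota chi \/ g = 1,
    ev g != 0, y = ev f / ev g & o = vsub (nuPhi f) (nuPhi g)].

(** The value is unspecified at elements that are not fractions of the allowed form. *)
Definition minorant (y : L) : option G := epsilon (inhabits None) (minorant_rel y).

Hypothesis Phi_key : w_key iota chi nu Phi.

Let nu_mod : module_valuation iota chi nu.
Proof. by case: nu_pm. Qed.

Let nu_mul f g : lt_dim (deg f + deg g) ->
  nu (ev f * ev g) = vadd (nu (ev f)) (nu (ev g)).
Proof. by case: nu_pm => _ + _; apply. Qed.

Lemma val_Phi_finite : exists v, nu (ev Phi) = Some v.
Proof.
case E: (nu _) => [v|]; first by exists v.
by move: Phi_nonconst; rewrite (val_ev_eq0 nu_mod Phi_deg E) /deg size_poly0.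
Qed.

(** Independence of the representation. In the algebraic case the reduced numerator is unique; in
    the transcendental case f g' = f' g holds for polynomials, and multiplicativity of [nuPhi] with
    finite values of g and g' gives equal differences. *)
Lemma minorant_frac f g : lt_dim (deg f) ->
  ~ algebraicOver iota chi \/ g = 1 -> ev g != 0 ->
  minorant (ev f / ev g) = vsub (nuPhi f) (nuPhi g).
Proof.
move=> Df Hg g0; rewrite /minorant.
have: exists o, minorant_rel (ev f / ev g) o.
  by exists (vsub (nuPhi f) (nuPhi g)), f, g.
move=> /(epsilon_spec (inhabits None)) [f' [g' [Df' Hg' g'0 E ->]]].
have [v PhiE] := val_Phi_finite.
have [alg|trans] := classic (algebraicOver iota chi).
  case: Hg Hg' E => // -> [//|->]; rewrite ev1 !divr1.
  by move=> /(lt_dim_ev_inj Df Df') ->.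
have D m : lt_dim m by apply: lt_dim_transcendental.
have finite h : ev h != 0 -> exists c, nuPhi h = Some c.
  move=> h0; case Eh: (nuPhi h) => [c|]; first by exists c.
  by move: h0; rewrite (nuPhi_eq0 nu_mod Phi_nonconst Phi_deg PhiE Eh) ev0 eqxx.
have fg: f * g' = f' * g.
  apply: (lt_dim_ev_inj (D _) (D _)); rewrite !evM; apply/eqP.
  by rewrite -eqr_div // E.
have := congr1 nuPhi fg.
rewrite !(nuPhiM nu_mod nu_mul Phi_nonconst Phi_deg PhiE Phi_key) //.
have [c ->] := finite _ g0; have [c' ->] := finite _ g'0.
case: (nuPhi f) => [b|]; case: (nuPhi f') => [b'|] //= [bb]; congr Some.
apply/eqP; rewrite subr_eq addrAC eq_sym subr_eq; exact/eqP.
Qed.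

Lemma minorant_ev f : lt_dim (deg f) -> minorant (ev f) = nuPhi f.
Proof.
move=> Df; have := minorant_frac (g := 1) Df (or_intror erefl).
rewrite ev1 divr1 nuPhi1 // oner_neq0 => -> //.
by case: (nuPhi f) => [c|//]; rewrite /vsub subr0.
Qed.

Lemma minorant_is_nu_Phi : is_nu_Phi iota chi nu Phi minorant.
Proof.
move=> m a exp_a; rewrite minorant_ev; last exact: is_expansion_lt_dim_sum.
by rewrite nuPhi_expansion // => i; apply: is_expansion_size exp_a.
Qed.

Lemma minorant_small f : poly_le (deg Phi).-1 f -> minorant (ev f) = nu (ev f).
Proof.
rewrite poly_leE // => lt_f; rewrite minorant_ev ?nuPhi_small //.
exact: lt_dim_small lt_f.
Qed.

Lemma minorant_mul f g : lt_dim (deg f + deg g) ->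
  minorant (ev f * ev g) = vadd (minorant (ev f)) (minorant (ev g)).
Proof.
move=> D; have [v PhiE] := val_Phi_finite.
rewrite -evM !minorant_ev.
- exact: (nuPhiM nu_mod nu_mul Phi_nonconst Phi_deg PhiE Phi_key).
- by apply: lt_dim_leq D; apply: leq_addl.
- by apply: lt_dim_leq D; apply: leq_addr.
- by apply: lt_dim_leq D; apply: degM.
Qed.

Lemma minorant_module_valuation : module_valuation iota chi minorant.
Proof.
have [v PhiE] := val_Phi_finite.
split=> [y Ky|y1 y2 Ky1 Ky2|x y Ky].
- have [f Df ->] := Kadj_reduced Ky; rewrite minorant_ev //; split.
    by move=> /(nuPhi_eq0 nu_mod Phi_nonconst Phi_deg PhiE) ->; rewrite ev0.
  by move=> /(lt_dim_ev_eq0 Df) ->; apply: nuPhi0.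
- have [f Df ->] := Kadj_reduced Ky1; have [g Dg ->] := Kadj_reduced Ky2.
  rewrite -evD !minorant_ev //; first exact: (nuPhiD nu_mod Phi_nonconst PhiE).
  by apply: lt_dim_leq (degD f g) _; rewrite /maxn; case: ifP.
(* A scalar is the value of a constant polynomial, of degree 0, so this is a case of
   multiplicativity. *)
have [f Df ->] := Kadj_reduced Ky; rewrite -(evC iota chi).
by apply: minorant_mul; rewrite /deg size_polyC; case: eqP.
Qed.

Lemma minorant_pm_valuation : pm_valuation iota chi minorant.
Proof.
split; [exact: minorant_module_valuation | exact: minorant_mul |].
move=> trans f g g0; have D m : lt_dim m by apply: lt_dim_transcendental.
by rewrite minorant_frac ?minorant_ev //; left.
Qed.

Lemma minorant_separated_minorant : separated_minorant iota chi nu Phi minorant.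
Proof.
have [v PhiE] := val_Phi_finite.
split.
- exact: minorant_pm_valuation.
- move=> y Ky; have [f Df ->] := Kadj_reduced Ky; rewrite minorant_ev //.
  exact: (nuPhi_le_val nu_mod nu_mul Phi_nonconst).
- exact: minorant_small.
- move=> f g lt_f lt_g D.
  rewrite minorant_mul // !minorant_small // -?Phi_key ?nu_mul //.
  exact: poly_le_mod.
(* It remains to compare term by term: a_i is the only digit of a_i Phi^i that can be nonzero. *)
move=> m a exp_a; rewrite minorant_is_nu_Phi //.
apply: eq_bigr => i _; have Di := is_expansion_lt_dim Phi_nonconst i exp_a.
rewrite minorant_ev ?nuPhi_mulXn //; first exact: is_expansion_size exp_a.
by apply: lt_dim_leq Di; apply: leq_trans (degM _ _) _; rewrite leq_add2l degX.
Qed.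

End Minorant.

(** * The equivalence, with nu_Phi as witness *)

Theorem proposition2p12 (K L : fieldType) (iota : {rmorphism K -> L}) (chi : L)
    (G : orderedGroupType) (nu : L -> option G) (Phi : {poly K})
    (chi_notin_K : forall x : K, chi <> iota x)
    (nu_pm : pm_valuation iota chi nu)
    (nu_rank : finite_rank iota nu)
    (Phi_monic : Phi \is monic)
    (Phi_nonconst : (0 < deg Phi)%N)
    (Phi_deg : lt_dim iota chi (deg Phi)) :
  (w_key iota chi nu Phi <->
     exists nu' : L -> option G, separated_minorant iota chi nu Phi nu') /\
  (w_key iota chi nu Phi ->
     exists nu' : L -> option G,
       is_nu_Phi iota chi nu Phi nu' /\ separated_minorant iota chi nu Phi nu').
Proof.
split=> [|key]; last first.
  exists (minorant iota chi nu Phi); split.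
    exact: minorant_is_nu_Phi.
  exact: minorant_separated_minorant.
split=> [key|[nu' [[_ nu'M _] _ eq_nu key' _]] f g lt_f lt_g D].
  by exists (minorant iota chi nu Phi); apply: minorant_separated_minorant.
have [_ nuM _] := nu_pm.
(* Both valuations are multiplicative at (f, g) and agree on f, g and the remainder, all of degree
   below d; so the key property passes from nu' to nu. *)
rewrite nuM // -(eq_nu f) // -(eq_nu g) // -nu'M // key' // eq_nu //.
exact: poly_le_mod.
Qed.
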